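(* Let the sequence $(x^k,v^k,\xi^k)_{k\ge0}$ be generated either by the RSOF algorithm or by the ARSOF algorithm (both described in the context). Then $\xi^k>0$ for all $k\ge0$. Furthermore, both algorithms are unconditionally energy stable in the sense that the modified pseudo-energy is nonincreasing: $$\tilde{\mathcal E}^{k+1}\le\tilde{\mathcal E}^{k}\le\cdots\le\tilde{\mathcal E}^{0},\qquad k\ge0,$$ where $\tilde{\mathcal E}^{k+1}:=\xi^{k+1}\mathcal E(x^k,v^k)$ is nonnegative for all $k\ge0$.
   Context: $\mathbb R^N$ carries the standard inner product and norm $\|\cdot\|$. The function $f:\mathbb R^N\to\mathbb R$ is differentiable and has a minimizer. The pseudo-energy is $\mathcal E(x,v):=f(x)+\frac12\|v\|^2$. Standing assumption: $\mathcal E(x,v)>0$ for all $x,v$ (equivalently $f>0$ everywhere). $\mathcal L$ is a linear positive semidefinite operator on $\mathbb R^N$, $S>0$ is a constant, $I$ is the identity, and $\eta^k>0$ for all $k\ge1$. RSOF algorithm. Inputs: $x^0,v^0\in\mathbb R^N$, $\Delta t>0$, $\xi^0=1$. Set $x^{-1}=x^0$, $v^{-1}=v^0$, and write $\mathcal E^k:=\mathcal E(x^k,v^k)$ for $k\ge-1$. For $k=0,1,2,\dots$: (1) $z^{k+1}=\left(\frac{I}{\Delta t}+S\Delta t\,\mathcal L+\eta^{k+1}I\right)^{-1}\left(\frac{v^k}{\Delta t\,\xi^k}-\nabla f(x^k)\right)$; (2) if $\|z^{k+1}\|\ne0$, $\widetilde\xi^{k+1}=\dfrac{-\frac{\mathcal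 E^k}{\Delta t}+\sqrt{\left(\frac{\mathcal E^k}{\Delta t}\right)^2+4\eta^{k+1}\|z^{k+1}\|^2\frac{\xi^k\mathcal E^{k-1}}{\Delta t}}}{2\eta^{k+1}\|z^{k+1}\|^2}$; otherwise $\widetilde\xi^{k+1}=\dfrac{\xi^k\mathcal E^{k-1}}{\mathcal E^k}$; (3) $v^{k+1}=\widetilde\xi^{k+1}z^{k+1}$ and $x^{k+1}=x^k+\Delta t\,\widetilde\xi^{k+1}z^{k+1}$; (4) $\xi^{k+1}=\min\left\{\dfrac{\xi^k\mathcal E^{k-1}}{\mathcal E^k},\dfrac{\mathcal E^{k+1}}{\mathcal E^k}\right\}$. ARSOF algorithm. Inputs: $x^0,v^0\in\mathbb R^N$, $\Delta t^0>0$, $\xi^0=1$, and constants $\rho>1$, $\gamma>0$, $\Delta t_{\min}>0$; initialization as in RSOF. For $k=0,1,2,\dots$: if $\xi^k<\gamma$ and $\Delta t^k>\Delta t_{\min}$, set $\Delta t^{k+1}=\max\{\xi^k\Delta t^k,\Delta t_{\min}\}$; otherwise set $\Delta t^{k+1}=\rho\,\Delta t^k$. Then perform steps (1)–(4) of RSOF with $\Delta t=\Delta t^{k+1}$. The modified pseudo-energy is $\tilde{\mathcal E}^{k+1}:=\xi^{k+1}\mathcal E^k$ for $k\ge-1$; in particular $\tilde{\mathcal E}^0=\xi^0\mathcal E^{-1}=\mathcal E(x^0,v^0)$. *)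

(* Defs.v *)
From HB Require Import structures.
From mathcomp Require Import all_boot all_order all_algebra.
From mathcomp Require Import all_classical all_reals all_analysis.

Set Implicit Arguments.
Unset Strict Implicit.
Unset Printing Implicit Defensive.

Import Order.TTheory GRing.Theory Num.Theory.
Import numFieldNormedType.Exports.

Local Open Scope ring_scope.

Section Euclidean.
Context {R : realType} {N : nat}.
Implicit Types (u v x : 'cV[R]_N).

Definition dotp u v : R := \sum_(i < N) u i 0 * v i 0.

(* The library norm `|u| on matrices is the max norm, not the Euclidean one.
   Since all norms on R^N are equivalent, [differentiable] is unaffected. *)
Definition enorm u : R := Num.sqrt (dotp u u).

Definition grad (f : 'cV[R]_N -> R) x : 'cV[R]_N :=
  \col_(i < N) 'D_(delta_mx i 0) f x.

(* Symmetry of L is not required. *)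
Definition psd (L : 'M[R]_N) : Prop := forall u, 0 <= dotp u (L *m u).

End Euclidean.

Section Algorithms.
Context {R : realType} {N : nat}.
Variables (f : 'cV[R]_N -> R) (L : 'M[R]_N) (S : R) (eta : nat -> R).

Definition pseudo_energy (x v : 'cV[R]_N) : R := f x + 2^-1 * enorm v ^+ 2.

Definition z_update (dt e xi : R) (x v : 'cV[R]_N) : 'cV[R]_N :=
  invmx (dt^-1%:M + (S * dt) *: L + e%:M) *m ((dt * xi)^-1 *: v - grad f x).

(* Here Ek and Eprev stand for E^k and E^{k-1}. *)
Definition xi_tilde_update (dt e xi Ek Eprev : R) (z : 'cV[R]_N) : R :=
  if enorm z != 0 then
    (- (Ek / dt) +
       Num.sqrt ((Ek / dt) ^+ 2 + 4 * e * enorm z ^+ 2 * (xi * Eprev / dt)))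
    / (2 * e * enorm z ^+ 2)
  else xi * Eprev / Ek.

Variables (x v : nat -> 'cV[R]_N) (xi : nat -> R).

Definition energy_seq (k : nat) : R := pseudo_energy (x k) (v k).

(* E^{k-1} for k >= 0: since 0.-1 = 0, this encodes x^{-1} = x^0, v^{-1} = v^0. *)
Definition energy_prev (k : nat) : R := energy_seq k.-1.

Definition sof_step (dt : R) (k : nat) : Prop :=
  let z := z_update dt (eta k.+1) (xi k) (x k) (v k) in
  let xit := xi_tilde_update dt (eta k.+1) (xi k)
               (energy_seq k) (energy_prev k) z in
  [/\ v k.+1 = xit *: z,
      x k.+1 = x k + (dt * xit) *: z
    & xi k.+1 = Num.min (xi k * energy_prev k / energy_seq k)
                        (energy_seq k.+1 / energy_seq k)].

Definition RSOF (dt : R) : Prop :=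
  [/\ 0 < dt, xi 0%N = 1 & forall k, sof_step dt k].

Definition next_dt (rho gamma dtmin xik dtk : R) : R :=
  if (xik < gamma) && (dtmin < dtk) then Num.max (xik * dtk) dtmin
  else rho * dtk.

Definition ARSOF (rho gamma dtmin : R) (dt : nat -> R) : Prop :=
  [/\ 1 < rho, 0 < gamma, 0 < dtmin & 0 < dt 0%N] /\
  [/\ xi 0%N = 1,
      forall k, dt k.+1 = next_dt rho gamma dtmin (xi k) (dt k)
    & forall k, sof_step (dt k.+1) k].

(* Index shift: this is xi^k E^{k-1}, so that its value at k.+1 is
   xi^{k+1} E(x^k, v^k), and its value at 0 is xi^0 E(x^0, v^0). *)
Definition modified_energy (k : nat) : R := xi k * energy_prev k.

End Algorithms.

(* Main.v *)
Require Import Defs.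
From HB Require Import structures.
From mathcomp Require Import all_boot all_order all_algebra.
From mathcomp Require Import all_classical all_reals all_analysis.

Set Implicit Arguments.
Unset Strict Implicit.
Unset Printing Implicit Defensive.

Import Order.TTheory GRing.Theory Num.Theory.
Import numFieldNormedType.Exports.

Local Open Scope ring_scope.

(** Stability comes entirely from the last step of an iteration, the relaxation
    [xi_{k+1} = min (xi_k E_{k-1} / E_k) (E_{k+1} / E_k)]. Both arguments of the
    minimum are quotients of positive numbers as soon as [xi_k] is positive, so
    positivity propagates from [xi_0 = 1] ([relaxation_gt0]). Bounding the
    minimum by its first argument and multiplying by [E_k] gives
    [xi_{k+1} E_k <= xi_k E_{k-1}] ([relaxation_nonincreasing]).

    The recursion for [xi] is the same whether the time step is fixed or
    adapted, so both schemes are instances of one statement about a positive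
    sequence [E] and its relaxation sequence [xi]. *)

Section Relaxation.
Context {R : realType}.
Variables (E xi : nat -> R).
Hypothesis E_gt0 : forall k, 0 < E k.
Hypothesis xi_init : xi 0%N = 1.
Hypothesis xi_relax : forall k,
  xi k.+1 = Num.min (xi k * E k.-1 / E k) (E k.+1 / E k).

Lemma relaxation_gt0 k : 0 < xi k.
Proof.
elim: k => [|k xi_gt0]; first by rewrite xi_init.
by rewrite xi_relax lt_min !divr_gt0 ?mulr_gt0.
Qed.

(** The denominator of the first argument of the minimum is exactly the energy
    that multiplies [xi k.+1] in the modified energy. *)
Lemma relaxation_nonincreasing :
  nonincreasing_seq (fun k => xi k * E k.-1).
Proof.
apply/nonincreasing_seqP => k /=.
by rewrite -ler_pdivlMr // xi_relax ge_min lexx.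
Qed.

End Relaxation.

Theorem theorem2p2 (R : realType) (N : nat) (f : 'cV[R]_N -> R)
    (f_diff : forall x : 'cV[R]_N, differentiable f x)
    (f_min : exists xstar : 'cV[R]_N, forall x : 'cV[R]_N, f xstar <= f x)
    (E_pos : forall x v : 'cV[R]_N, 0 < pseudo_energy f x v)
    (L : 'M[R]_N) (L_psd : psd L)
    (S : R) (S_gt0 : 0 < S)
    (eta : nat -> R) (eta_gt0 : forall k : nat, (1 <= k)%N -> 0 < eta k)
    (x v : nat -> 'cV[R]_N) (xi : nat -> R)
    (generated :
       (exists dt : R, RSOF f L S eta x v xi dt) \/
       (exists (rho gamma dtmin : R) (dt : nat -> R),
          ARSOF f L S eta x v xi rho gamma dtmin dt)) :
  [/\ forall k : nat, 0 < xi k,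
      nonincreasing_seq (modified_energy f x v xi)
    & forall k : nat, 0 <= modified_energy f x v xi k.+1].
Proof.
have E_gt0 k : 0 < energy_seq f x v k by exact: E_pos.
have [xi0 xi_relax] : xi 0%N = 1 /\ forall k, xi k.+1 =
    Num.min (xi k * energy_seq f x v k.-1 / energy_seq f x v k)
            (energy_seq f x v k.+1 / energy_seq f x v k).
  case: generated => [[dt [_ xi0 step]]|[rho [gamma [dtmin [dt [_ [xi0 _ step]]]]]]].
    by split=> // k; case: (step k).
  by split=> // k; case: (step k).
have xi_gt0 := relaxation_gt0 E_gt0 xi0 xi_relax.
split=> [//||k]; first exact: (relaxation_nonincreasing E_gt0 xi_relax).
by apply/ltW/mulr_gt0; [exact: xi_gt0|exact: E_gt0].
Qed.
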